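(* Let $w$ and $v$ be the four-term weight systems, $w=(w_0,w_1,w_2,w_3;h)$ and $v=(v_0,v_1,v_2,v_3;k)$, of a mirror symmetric pair of simple K3 hypersurface singularities, i.e. $\{w,v\}$ is one of the pairs listed in the context. Then the corresponding Calabi-Yau weight systems are strongly coupled. That is: one can order the weights of $w$ as $(a_0,a_1,a_2,a_3)$ with $a_0\mid h$ and the weights of $v$ as $(b_0,b_1,b_2,b_3)$ with $b_0\mid k$ in such a way that the weight systems $W_{\mathbf a}=(a_1,a_2,a_3;h)$ and $W_{\mathbf b}=(b_1,b_2,b_3;k)$ are strongly coupled.
   Context: A weight system is a tuple of positive integers $W_{\mathbf a}=(a_1,\dots,a_n;h)$; put $a_0:=h-\sum_{i=1}^n a_i$. It is called a Calabi-Yau weight system if $a_0>0$ and $a_0\mid h$. An $n\times n$ matrix $C=(c_{ij})$ with non-negative integer entries is a weighted magic square of weight $(W_{\mathbf a},W_{\mathbf b})$, where $W_{\mathbf b}=(b_1,\dots,b_n;k)$, if $C(a_1,\dots,a_n)^t=(h,\dots,h)^t$ and $(b_1,\dots,b_n)C=(k,\dots,k)$. It is almost primitive if $|\det C|=hb_0=ka_0$, where $b_0:=k-\sum_{i=1}^n b_i$. The weight systems $W_{\mathbf a}$ and $W_{\mathbf b}$ are coupled if there is an almost primitive weighted magic square of weight $(W_{\mathbf a},W_{\mathbf b})$; they are strongly coupled if there is such a $C$ for which moreover every row and every column contains at least one zero. Simple K3 hypersurface singularities are the cones over the quasismooth K3 hypersurfaces with Gorenstein singularities in weighted projective 3-spaces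 $\mathbb P(w_0,w_1,w_2,w_3)$ of degree $h=w_0+w_1+w_2+w_3$; there are 95 families (lists of Reid and Yonemura). Belcastro determined the pairs of families in this list that are mirror symmetric to each other. The weight systems occurring, with Yonemura's numbers, are (the order of the weights is immaterial): 1: (1,1,1,1;4); 4: (1,3,4,4;12); 5: (1,1,1,3;6); 6: (1,2,2,5;10); 7: (1,1,2,4;8); 9: (1,4,5,10;20); 10: (1,1,4,6;12); 11: (2,3,10,15;30); 12: (1,2,6,9;18); 13: (1,3,8,12;24); 14: (1,6,14,21;42); 20: (1,6,8,9;24); 21: (1,1,1,2;5); 22: (1,3,5,6;15); 24: (1,2,4,5;12); 25: (1,1,3,4;9); 26: (2,4,5,9;20); 27: (2,3,8,11;24); 28: (1,3,7,10;21); 30: (5,7,8,20;40); 32: (2,2,3,7;14); 34: (2,6,7,15;30); 35: (3,4,7,14;28); 37: (1,3,4,8;16); 38: (1,6,8,15;30); 39: (1,3,5,9;18); 40: (1,2,4,7;14); 42: (1,1,3,5;10); 43: (3,4,11,18;36); 45: (1,4,9,14;28); 46: (5,6,22,33;66); 48: (3,5,16,24;48); 49: (2,5,14,21;42); 50: (1,4,10,15;30); 51: (1,5,12,18;36); 52: (7,8,9,12;36); 56: (5,6,8,11;30); 58: (1,4,5,6;16); 59: (1,5,7,8;21); 60: (1,4,6,7;18); 64: (3,4,7,10;24); 65: (3,5,11,14;33); 66: (1,1,2,3;7); 68: (3,4,10,13;30); 71: (1,3,4,7;15); 72: (1,2,5,7;15); 73: (7,8,10,25;50); 76: (2,5,6,13;26);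 77: (1,5,7,13;26); 78: (1,4,6,11;22); 80: (4,5,13,22;44); 81: (2,3,8,13;26); 82: (1,3,7,11;22); 83: (4,5,18,27;54); 86: (4,5,7,9;25); 87: (1,3,4,5;13); 88: (2,5,9,11;27); 92: (3,5,11,19;38). The mirror symmetric pairs are (by number): 14–14, 14–28, 14–45, 14–51, 28–28, 28–45, 28–51, 45–45, 45–51, 51–51; 50–38, 50–77, 38–82, 77–82; 13–20, 13–59, 20–72, 59–72; 78–78; 39–60; 22–22; 9–9, 9–71, 71–71; 37–58; 87–87; 4–4; 12–27, 12–49; 40–81; 24–11; 6–26, 6–34, 6–76; 10–65, 10–80, 10–46; 42–68, 42–92, 42–83; 25–43, 25–88, 25–48; 7–64; 66–35; 21–86, 21–30; 5–56, 5–73; 1–52; 32–32. *)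

(* Defs.v *)
From HB Require Import structures.
From mathcomp Require Import all_boot all_order all_algebra.
Set Implicit Arguments.
Unset Strict Implicit.
Unset Printing Implicit Defensive.
Import Order.TTheory GRing.Theory Num.Theory.
Local Open Scope ring_scope.

Record weight_system (n : nat) := WeightSystem {
  weights : n.-tuple nat;
  degree : nat;
  weights_gt0 : all (ltn 0) weights;
  degree_gt0 : (0 < degree)%N
}.

(* The integer h - (a_1 + ... + a_n) attached to (a_1, ..., a_n; h), written
   a_0 in the comments below; it may be negative. *)
Definition coweight n (W : weight_system n) : int :=
  (degree W)%:Z - \sum_(i < n) (tnth (weights W) i)%:Z.

Definition calabi_yau n (W : weight_system n) : Prop :=
  0 < coweight W /\ (coweight W %| (degree W)%:Z)%Z.

Definition weighted_magic_square n (Wa Wb : weight_system n) (C : 'M[nat]_n)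
    : Prop :=
  C *m (\col_i tnth (weights Wa) i) = const_mx (degree Wa) /\
  (\row_i tnth (weights Wb) i) *m C = const_mx (degree Wb).

(* |det C| = h b_0 = k a_0, the determinant being taken over the integers. *)
Definition almost_primitive n (Wa Wb : weight_system n) (C : 'M[nat]_n)
    : Prop :=
  `|\det (map_mx Posz C)| = (degree Wa)%:Z * coweight Wb /\
  (degree Wa)%:Z * coweight Wb = (degree Wb)%:Z * coweight Wa.

Definition strongly_coupled n (Wa Wb : weight_system n) : Prop :=
  exists C : 'M[nat]_n,
    [/\ weighted_magic_square Wa Wb C,
        almost_primitive Wa Wb C,
        forall i, exists j, C i j = 0%N
      & forall j, exists i, C i j = 0%N].

(* The weight systems of simple K3 hypersurface singularities that occur in a
   mirror pair, labelled by their numbers in Yonemura's list of 95. *)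
Definition yonemura_table : seq (nat * (seq nat * nat)) :=
  [:: (1, ([:: 1; 1; 1; 1], 4));
      (4, ([:: 1; 3; 4; 4], 12));
      (5, ([:: 1; 1; 1; 3], 6));
      (6, ([:: 1; 2; 2; 5], 10));
      (7, ([:: 1; 1; 2; 4], 8));
      (9, ([:: 1; 4; 5; 10], 20));
      (10, ([:: 1; 1; 4; 6], 12));
      (11, ([:: 2; 3; 10; 15], 30));
      (12, ([:: 1; 2; 6; 9], 18));
      (13, ([:: 1; 3; 8; 12], 24));
      (14, ([:: 1; 6; 14; 21], 42));
      (20, ([:: 1; 6; 8; 9], 24));
      (21, ([:: 1; 1; 1; 2], 5));
      (22, ([:: 1; 3; 5; 6], 15));
      (24, ([:: 1; 2; 4; 5], 12));
      (25, ([:: 1; 1; 3; 4], 9));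
      (26, ([:: 2; 4; 5; 9], 20));
      (27, ([:: 2; 3; 8; 11], 24));
      (28, ([:: 1; 3; 7; 10], 21));
      (30, ([:: 5; 7; 8; 20], 40));
      (32, ([:: 2; 2; 3; 7], 14));
      (34, ([:: 2; 6; 7; 15], 30));
      (35, ([:: 3; 4; 7; 14], 28));
      (37, ([:: 1; 3; 4; 8], 16));
      (38, ([:: 1; 6; 8; 15], 30));
      (39, ([:: 1; 3; 5; 9], 18));
      (40, ([:: 1; 2; 4; 7], 14));
      (42, ([:: 1; 1; 3; 5], 10));
      (43, ([:: 3; 4; 11; 18], 36));
      (45, ([:: 1; 4; 9; 14], 28));
      (46, ([:: 5; 6; 22; 33], 66));
      (48, ([:: 3; 5; 16; 24], 48));
      (49, ([:: 2; 5; 14; 21], 42));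
      (50, ([:: 1; 4; 10; 15], 30));
      (51, ([:: 1; 5; 12; 18], 36));
      (52, ([:: 7; 8; 9; 12], 36));
      (56, ([:: 5; 6; 8; 11], 30));
      (58, ([:: 1; 4; 5; 6], 16));
      (59, ([:: 1; 5; 7; 8], 21));
      (60, ([:: 1; 4; 6; 7], 18));
      (64, ([:: 3; 4; 7; 10], 24));
      (65, ([:: 3; 5; 11; 14], 33));
      (66, ([:: 1; 1; 2; 3], 7));
      (68, ([:: 3; 4; 10; 13], 30));
      (71, ([:: 1; 3; 4; 7], 15));
      (72, ([:: 1; 2; 5; 7], 15));
      (73, ([:: 7; 8; 10; 25], 50));
      (76, ([:: 2; 5; 6; 13], 26));
      (77, ([:: 1; 5; 7; 13], 26));
      (78, ([:: 1; 4; 6; 11], 22));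
      (80, ([:: 4; 5; 13; 22], 44));
      (81, ([:: 2; 3; 8; 13], 26));
      (82, ([:: 1; 3; 7; 11], 22));
      (83, ([:: 4; 5; 18; 27], 54));
      (86, ([:: 4; 5; 7; 9], 25));
      (87, ([:: 1; 3; 4; 5], 13));
      (88, ([:: 2; 5; 9; 11], 27));
      (92, ([:: 3; 5; 11; 19], 38))]%N.

(* Belcastro's mirror symmetric pairs, by Yonemura number; each unordered pair
   is listed once. *)
Definition mirror_pairs : seq (nat * nat) :=
  [:: (14, 14); (14, 28); (14, 45); (14, 51); (28, 28); (28, 45);
      (28, 51); (45, 45); (45, 51); (51, 51); (50, 38); (50, 77);
      (38, 82); (77, 82); (13, 20); (13, 59); (20, 72); (59, 72);
      (78, 78); (39, 60); (22, 22); (9, 9); (9, 71); (71, 71);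
      (37, 58); (87, 87); (4, 4); (12, 27); (12, 49); (40, 81);
      (24, 11); (6, 26); (6, 34); (6, 76); (10, 65); (10, 80);
      (10, 46); (42, 68); (42, 92); (42, 83); (25, 43); (25, 88);
      (25, 48); (7, 64); (66, 35); (21, 86); (21, 30); (5, 56);
      (5, 73); (1, 52); (32, 32)]%N.

(* The order of the weights is immaterial. *)
Definition yonemura_number (i : nat) (w : weight_system 4) : Prop :=
  exists s : seq nat,
    (i, (s, degree w)) \in yonemura_table /\ perm_eq (weights w) s.

Definition mirror_symmetric (w v : weight_system 4) : Prop :=
  exists i j : nat,
    [/\ (i, j) \in mirror_pairs \/ (j, i) \in mirror_pairs,
        yonemura_number i w
      & yonemura_number j v].

(* Main.v *)
(** Strong coupling is symmetric, the transpose of a magic square being a magic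
    square for the exchanged weights, so one matrix per unordered pair suffices;
    each was found by a search through the non-negative solutions of
    [c . a = h]. *)

Require Import Defs.
From mathcomp Require Import all_boot all_order all_algebra.
From mathcomp Require Import zify ring.

Set Implicit Arguments.
Unset Strict Implicit.
Unset Printing Implicit Defensive.
Import Order.TTheory GRing.Theory Num.Theory.
Local Open Scope ring_scope.

(** * Determinants of order three and the symmetry of strong coupling *)

(** Laplace expansion, applied twice. Indexing the entries by [nat] lets the ordinals left by the
    expansion reduce to numerals. *)
Lemma det_mx33 (R : comNzRingType) (f : nat -> nat -> R) :
  \det (\matrix_(i < 3, j < 3) f i j) =
    f 0 0 * (f 1 1 * f 2 2 - f 1 2 * f 2 1)
    - f 0 1 * (f 1 0 * f 2 2 - f 1 2 * f 2 0)
    + f 0 2 * (f 1 0 * f 2 1 - f 1 1 * f 2 0).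
Proof.
rewrite (expand_det_row _ ord0) !big_ord_recl big_ord0 /cofactor.
rewrite !(expand_det_row _ ord0) !big_ord_recl !big_ord0 /cofactor.
by rewrite !det_mx11 !mxE /= /bump /=; ring.
Qed.

Lemma strongly_coupled_sym n (Wa Wb : weight_system n) :
  strongly_coupled Wa Wb -> strongly_coupled Wb Wa.
Proof.
case=> C [[Ca bC] [detC hb_ka] row0 col0]; exists C^T; split=> //.
- split; apply: trmx_inj; rewrite trmx_mul trmxK trmx_const.
  + by rewrite -[RHS]bC; congr (_ *m _); apply/matrixP=> i j; rewrite !mxE.
  + by rewrite -[RHS]Ca; congr (_ *m _); apply/matrixP=> i j; rewrite !mxE.
(* The equation [h b_0 = k a_0] turns the value required of [|det C|] for one order of the weight
   systems into that for the other. *)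
- by split; rewrite -?hb_ka // -map_trmx det_tr.
- by move=> i; have [j Cji] := col0 i; exists j; rewrite mxE.
- by move=> j; have [i Cji] := row0 j; exists i; rewrite mxE.
Qed.

(** The conclusion of the theorem as a relation, so that its symmetry can be stated and applied. *)
Definition strongly_coupled_orderings (w v : weight_system 4) : Prop :=
  exists (a0 b0 : nat) (Wa Wb : weight_system 3),
    [/\ perm_eq (a0 :: weights Wa) (weights w),
        degree Wa = degree w
      & (a0 %| degree w)%N] /\
    [/\ perm_eq (b0 :: weights Wb) (weights v),
        degree Wb = degree v
      & (b0 %| degree v)%N] /\
    [/\ calabi_yau Wa, calabi_yau Wb & strongly_coupled Wa Wb].

Lemma strongly_coupled_orderings_sym w v :
  strongly_coupled_orderings w v -> strongly_coupled_orderings v w.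
Proof.
move=> [a0 [b0 [Wa [Wb [Hw [Hv [cyA cyB /strongly_coupled_sym sc]]]]]]].
by exists b0, a0, Wb, Wa.
Qed.

(** * Decidable certificates for strong coupling, in natural-number arithmetic *)

(* [(dp - dm) + (dm - dp)] is [|det C|]: one of the truncated differences is 0. *)
Definition coupling_certificate (h k : nat)
    (c : seq nat * seq nat * seq (seq nat)) : bool :=
  if c is ([:: a0; a1; a2; a3], [:: b0; b1; b2; b3],
           [:: [:: x; y; z]; [:: x'; y'; z']; [:: x''; y''; z'']])
  then [&& (a0 + a1 + a2 + a3 == h) && (b0 + b1 + b2 + b3 == k),
           (a0 %| h) && (b0 %| k),
           [&& x * a1 + y * a2 + z * a3 == h,
               x' * a1 + y' * a2 + z' * a3 == h
             & x'' * a1 + y'' * a2 + z'' * a3 == h],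
           [&& b1 * x + b2 * x' + b3 * x'' == k,
               b1 * y + b2 * y' + b3 * y'' == k
             & b1 * z + b2 * z' + b3 * z'' == k],
           let dp := x * y' * z'' + y * z' * x'' + z * x' * y'' in
           let dm := x * z' * y'' + y * x' * z'' + z * y' * x'' in
           ((dp - dm) + (dm - dp) == h * b0) && (h * b0 == k * a0),
           [&& 0 \in [:: x; y; z], 0 \in [:: x'; y'; z']
             & 0 \in [:: x''; y''; z'']]
         & [&& 0 \in [:: x; x'; x''], 0 \in [:: y; y'; y'']
             & 0 \in [:: z; z'; z'']]]%N
  else false.

(* The distinguished weights a_0 and b_0 come first. *)
Definition coupling_certificates : seq (seq nat * seq nat * seq (seq nat)) :=
  [:: ([:: 1; 6; 14; 21], [:: 1; 6; 14; 21],
       [:: [:: 7; 0; 0]; [:: 0; 3; 0]; [:: 0; 0; 2]]);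
      ([:: 6; 1; 14; 21], [:: 3; 1; 7; 10],
       [:: [:: 21; 0; 1]; [:: 0; 3; 0]; [:: 0; 0; 2]]);
      ([:: 6; 1; 14; 21], [:: 4; 1; 9; 14],
       [:: [:: 28; 1; 0]; [:: 0; 3; 0]; [:: 0; 0; 2]]);
      ([:: 14; 1; 6; 21], [:: 12; 1; 5; 18],
       [:: [:: 36; 1; 0]; [:: 0; 7; 0]; [:: 0; 0; 2]]);
      ([:: 3; 1; 7; 10], [:: 3; 1; 7; 10],
       [:: [:: 11; 0; 1]; [:: 0; 3; 0]; [:: 1; 0; 2]]);
      ([:: 3; 1; 7; 10], [:: 4; 1; 9; 14],
       [:: [:: 14; 1; 0]; [:: 0; 3; 0]; [:: 1; 0; 2]]);
      ([:: 7; 1; 3; 10], [:: 12; 1; 5; 18],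
       [:: [:: 18; 1; 0]; [:: 0; 7; 0]; [:: 1; 0; 2]]);
      ([:: 4; 1; 9; 14], [:: 4; 1; 9; 14],
       [:: [:: 19; 1; 0]; [:: 1; 3; 0]; [:: 0; 0; 2]]);
      ([:: 14; 1; 4; 9], [:: 18; 1; 5; 12],
       [:: [:: 24; 1; 0]; [:: 0; 7; 0]; [:: 1; 0; 3]]);
      ([:: 12; 1; 5; 18], [:: 12; 1; 5; 18],
       [:: [:: 31; 1; 0]; [:: 1; 7; 0]; [:: 0; 0; 2]]);
      ([:: 1; 4; 10; 15], [:: 1; 6; 8; 15],
       [:: [:: 5; 1; 0]; [:: 0; 3; 0]; [:: 0; 0; 2]]);
      ([:: 15; 1; 4; 10], [:: 13; 1; 5; 7],
       [:: [:: 26; 1; 0]; [:: 0; 5; 1]; [:: 0; 0; 3]]);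
      ([:: 15; 1; 6; 8], [:: 11; 1; 3; 7],
       [:: [:: 22; 0; 1]; [:: 0; 5; 0]; [:: 0; 1; 3]]);
      ([:: 13; 1; 5; 7], [:: 11; 1; 3; 7],
       [:: [:: 19; 0; 1]; [:: 1; 5; 0]; [:: 0; 1; 3]]);
      ([:: 1; 3; 8; 12], [:: 1; 6; 8; 9],
       [:: [:: 4; 0; 1]; [:: 0; 3; 0]; [:: 0; 0; 2]]);
      ([:: 8; 1; 3; 12], [:: 7; 1; 5; 8],
       [:: [:: 21; 1; 0]; [:: 0; 4; 1]; [:: 0; 0; 2]]);
      ([:: 8; 1; 6; 9], [:: 5; 1; 2; 7],
       [:: [:: 15; 0; 1]; [:: 0; 4; 0]; [:: 0; 1; 2]]);
      ([:: 7; 1; 5; 8], [:: 5; 1; 2; 7],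
       [:: [:: 13; 0; 1]; [:: 1; 4; 0]; [:: 0; 1; 2]]);
      ([:: 1; 4; 6; 11], [:: 1; 4; 6; 11],
       [:: [:: 4; 1; 0]; [:: 1; 3; 0]; [:: 0; 0; 2]]);
      ([:: 1; 3; 5; 9], [:: 1; 4; 6; 7],
       [:: [:: 3; 0; 1]; [:: 1; 3; 0]; [:: 0; 0; 2]]);
      ([:: 1; 3; 5; 6], [:: 1; 3; 5; 6],
       [:: [:: 3; 0; 1]; [:: 0; 3; 0]; [:: 1; 0; 2]]);
      ([:: 1; 4; 5; 10], [:: 1; 4; 5; 10],
       [:: [:: 5; 0; 0]; [:: 0; 0; 2]; [:: 0; 2; 1]]);
      ([:: 4; 1; 5; 10], [:: 3; 1; 4; 7],
       [:: [:: 15; 1; 0]; [:: 0; 0; 2]; [:: 0; 2; 1]]);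
      ([:: 3; 1; 4; 7], [:: 3; 1; 4; 7],
       [:: [:: 11; 1; 0]; [:: 1; 0; 2]; [:: 0; 2; 1]]);
      ([:: 1; 3; 4; 8], [:: 1; 4; 5; 6],
       [:: [:: 4; 1; 0]; [:: 0; 0; 2]; [:: 0; 2; 1]]);
      ([:: 1; 3; 4; 5], [:: 1; 3; 4; 5],
       [:: [:: 3; 1; 0]; [:: 1; 0; 2]; [:: 0; 2; 1]]);
      ([:: 1; 3; 4; 4], [:: 1; 3; 4; 4],
       [:: [:: 4; 0; 0]; [:: 0; 1; 2]; [:: 0; 2; 1]]);
      ([:: 6; 1; 2; 9], [:: 8; 2; 3; 11],
       [:: [:: 9; 0; 1]; [:: 2; 8; 0]; [:: 0; 0; 2]]);
      ([:: 6; 1; 2; 9], [:: 14; 2; 5; 21],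
       [:: [:: 16; 1; 0]; [:: 2; 8; 0]; [:: 0; 0; 2]]);
      ([:: 7; 1; 2; 4], [:: 13; 2; 3; 8],
       [:: [:: 10; 0; 1]; [:: 2; 6; 0]; [:: 0; 1; 3]]);
      ([:: 4; 1; 2; 5], [:: 10; 2; 3; 15],
       [:: [:: 12; 0; 0]; [:: 2; 5; 0]; [:: 0; 1; 2]]);
      ([:: 2; 1; 2; 5], [:: 4; 2; 5; 9],
       [:: [:: 5; 0; 1]; [:: 2; 4; 0]; [:: 0; 0; 2]]);
      ([:: 2; 1; 2; 5], [:: 6; 2; 7; 15],
       [:: [:: 8; 1; 0]; [:: 2; 4; 0]; [:: 0; 0; 2]]);
      ([:: 5; 1; 2; 2], [:: 13; 2; 5; 6],
       [:: [:: 8; 0; 1]; [:: 2; 4; 0]; [:: 0; 1; 4]]);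
      ([:: 4; 1; 1; 6], [:: 11; 3; 5; 14],
       [:: [:: 1; 11; 0]; [:: 6; 0; 1]; [:: 0; 0; 2]]);
      ([:: 6; 1; 1; 4], [:: 22; 4; 5; 13],
       [:: [:: 1; 11; 0]; [:: 8; 0; 1]; [:: 0; 0; 3]]);
      ([:: 4; 1; 1; 6], [:: 22; 5; 6; 33],
       [:: [:: 0; 12; 0]; [:: 11; 1; 0]; [:: 0; 0; 2]]);
      ([:: 1; 1; 3; 5], [:: 3; 4; 10; 13],
       [:: [:: 5; 0; 1]; [:: 1; 3; 0]; [:: 0; 0; 2]]);
      ([:: 5; 1; 1; 3], [:: 19; 3; 5; 11],
       [:: [:: 1; 9; 0]; [:: 7; 0; 1]; [:: 0; 1; 3]]);
      ([:: 5; 1; 1; 3], [:: 27; 4; 5; 18],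
       [:: [:: 1; 9; 0]; [:: 10; 0; 0]; [:: 0; 1; 3]]);
      ([:: 1; 1; 3; 4], [:: 4; 3; 11; 18],
       [:: [:: 6; 1; 0]; [:: 0; 3; 0]; [:: 1; 0; 2]]);
      ([:: 3; 1; 1; 4], [:: 9; 2; 5; 11],
       [:: [:: 1; 8; 0]; [:: 5; 0; 1]; [:: 0; 1; 2]]);
      ([:: 3; 1; 1; 4], [:: 16; 3; 5; 24],
       [:: [:: 1; 8; 0]; [:: 9; 0; 0]; [:: 0; 1; 2]]);
      ([:: 1; 1; 2; 4], [:: 3; 4; 7; 10],
       [:: [:: 6; 1; 0]; [:: 0; 0; 2]; [:: 0; 2; 1]]);
      ([:: 1; 1; 2; 3], [:: 4; 3; 7; 14],
       [:: [:: 7; 0; 0]; [:: 1; 0; 2]; [:: 0; 2; 1]]);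
      ([:: 1; 1; 1; 2], [:: 5; 4; 7; 9],
       [:: [:: 1; 4; 0]; [:: 3; 0; 1]; [:: 0; 1; 2]]);
      ([:: 1; 1; 1; 2], [:: 8; 5; 7; 20],
       [:: [:: 1; 4; 0]; [:: 5; 0; 0]; [:: 0; 1; 2]]);
      ([:: 1; 1; 1; 3], [:: 5; 6; 8; 11],
       [:: [:: 1; 5; 0]; [:: 3; 0; 1]; [:: 0; 0; 2]]);
      ([:: 3; 1; 1; 1], [:: 25; 7; 8; 10],
       [:: [:: 0; 0; 6]; [:: 0; 5; 1]; [:: 5; 1; 0]]);
      ([:: 1; 1; 1; 1], [:: 9; 7; 8; 12],
       [:: [:: 0; 0; 4]; [:: 0; 3; 1]; [:: 3; 1; 0]]);
      ([:: 2; 2; 3; 7], [:: 2; 2; 3; 7],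
       [:: [:: 1; 4; 0]; [:: 4; 2; 0]; [:: 0; 0; 2]])]%N.

(** * Soundness of the certificates *)

Lemma perm_weights_gt0 n s (w : weight_system n) :
  perm_eq s (weights w) -> all (ltn 0) s.
Proof. by move/perm_all->; apply: weights_gt0. Qed.

Lemma mem_nth_ord (T : eqType) (x0 x : T) n s :
  size s = n -> x \in s -> exists i : 'I_n, nth x0 s i = x.
Proof. by move=> <- /(nthP x0)[i lt_i <-]; exists (Ordinal lt_i). Qed.

(** Writing the degree as a sum over [nat] avoids subtraction: cancelling in [int] identifies the
    coweight with [a0], whose positivity and divisibility then carry over. *)
Lemma calabi_yau_coweight n (W : weight_system n) (a0 : nat) :
    (0 < a0)%N -> (a0 %| degree W)%N ->
    (a0 + \sum_(i < n) tnth (weights W) i)%N = degree W ->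
  calabi_yau W /\ coweight W = a0%:Z.
Proof.
move=> a0_gt0 a0_dvd sumW.
have cW : coweight W = a0%:Z.
  by rewrite /coweight -sumW PoszD (big_morph Posz PoszD (erefl _)) addrK.
by split; rewrite // /calabi_yau cW.
Qed.

Lemma normr_subz (m n : nat) : `|m%:Z - n%:Z| = ((m - n) + (n - m))%N%:Z.
Proof. lia. Qed.

Lemma coupling_certificateP w v c :
    perm_eq c.1.1 (weights w) -> perm_eq c.1.2 (weights v) ->
    coupling_certificate (degree w) (degree v) c ->
  strongly_coupled_orderings w v.
Proof.
case: c => [[a b] C] /= aw bv; rewrite /coupling_certificate.
(* On lists of any other shape the test evaluates to [false]. *)
case: a aw => [|a0 [|a1 [|a2 [|a3 [|? ?]]]]] // aw.
case: b bv => [|b0 [|b1 [|b2 [|b3 [|? ?]]]]] // bv.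
case: C => [|[|x [|y [|z [|? ?]]]] [|[|x' [|y' [|z' [|? ?]]]]
  [|[|x'' [|y'' [|z'' [|? ?]]]] [|? ?]]]] //.
set M := [:: [:: x; y; z]; [:: x'; y'; z']; [:: x''; y''; z'']].
case/and5P=> /andP[/eqP sum_a /eqP sum_b] /andP[a0h b0k].
move=> /and3P[/eqP r0 /eqP r1 /eqP r2] /and3P[/eqP c0 /eqP c1 /eqP c2].
case/and3P=> /andP[/eqP detM /eqP hb_ka] /and3P[zr0 zr1 zr2].
case/and3P=> zc0 zc1 zc2.
(* The certificate does not test positivity; it comes from the given weight systems through the
   permutations. *)
have /andP[a0_gt0 a_gt0] := perm_weights_gt0 aw.
have /andP[b0_gt0 b_gt0] := perm_weights_gt0 bv.
pose Wa := @WeightSystem 3 [tuple a1; a2; a3] _ a_gt0 (degree_gt0 w).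
pose Wb := @WeightSystem 3 [tuple b1; b2; b3] _ b_gt0 (degree_gt0 v).
have [|cyA cwA] := @calabi_yau_coweight 3 Wa a0 a0_gt0 a0h.
  by rewrite !big_ord_recl big_ord0 !(tnth_nth 0%N) /= -sum_a addn0 !addnA.
have [|cyB cwB] := @calabi_yau_coweight 3 Wb b0 b0_gt0 b0k.
  by rewrite !big_ord_recl big_ord0 !(tnth_nth 0%N) /= -sum_b addn0 !addnA.
exists a0, b0, Wa, Wb; do 2!split=> //; split=> //.
exists (\matrix_(i < 3, j < 3) nth 0%N (nth [::] M i) j); split.
- split.
  + apply/matrixP=> i j; rewrite !mxE !big_ord_recl big_ord0 !mxE.
    by case: i => [[|[|[|?]]] ?] //=;
      rewrite !(tnth_nth 0%N) /= ?addr0 ?addrA.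
  + apply/matrixP=> i j; rewrite !mxE !big_ord_recl big_ord0 !mxE.
    by case: j => [[|[|[|?]]] ?] //=;
      rewrite !(tnth_nth 0%N) /= ?addr0 ?addrA.
- split; rewrite cwB ?cwA -?PoszM ?hb_ka //.
  have -> : map_mx Posz (\matrix_(i < 3, j < 3) nth 0%N (nth [::] M i) j) =
      \matrix_(i < 3, j < 3) (nth 0%N (nth [::] M i) j)%:Z.
    by apply/matrixP=> i j; rewrite !mxE.
  rewrite (det_mx33 (fun i j => (nth 0%N (nth [::] M i) j)%:Z)) /=.
  (* The right-hand side becomes [|dp - dm|], where [dp] and [dm] collect the positive and the
     negative terms of the Leibniz formula. *)
  rewrite -hb_ka -detM -normr_subz; congr `|_|.
  by rewrite !PoszD !PoszM; ring.
- case=> [[|[|[|?]]] ?] //.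
  + by have [j Mj] := mem_nth_ord 0%N erefl zr0; exists j; rewrite mxE.
  + by have [j Mj] := mem_nth_ord 0%N erefl zr1; exists j; rewrite mxE.
  + by have [j Mj] := mem_nth_ord 0%N erefl zr2; exists j; rewrite mxE.
(* Columns are read as lists, to match the membership tests. Past the last row both sides take the
   default 0. *)
- have colM j i : nth 0%N (nth [::] M i) j = nth 0%N [seq nth 0%N r j | r <- M] i.
    by case: i => [|[|[|?]]]; rewrite /= ?nth_nil.
  case=> [[|[|[|?]]] ?] //.
  + by have [i Mi] := mem_nth_ord 0%N erefl zc0; exists i; rewrite mxE colM.
  + by have [i Mi] := mem_nth_ord 0%N erefl zc1; exists i; rewrite mxE colM.
  + by have [i Mi] := mem_nth_ord 0%N erefl zc2; exists i; rewrite mxE colM.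
Qed.

(** * The finite check over the table and its consequences *)

(* Filters rather than [==>], whose conclusion [vm_compute] evaluates even when
   the premise is false. *)
Definition certified_in (cs : seq (seq nat * seq nat * seq (seq nat)))
    (T : seq (nat * (seq nat * nat))) (i j : nat) : bool :=
  all (fun e =>
    all (fun f =>
      has (fun c => [&& perm_eq c.1.1 e.2.1, perm_eq c.1.2 f.2.1
                      & coupling_certificate e.2.2 f.2.2 c]) cs)
    [seq f <- T | f.1 == j])
  [seq e <- T | e.1 == i].

Lemma certified_inP cs T i j s t h k :
    certified_in cs T i j -> (i, (s, h)) \in T -> (j, (t, k)) \in T ->
  exists c, [&& perm_eq c.1.1 s, perm_eq c.1.2 t & coupling_certificate h k c].
Proof.
move=> /allP/(_ (i, (s, h))) + iT jT; rewrite mem_filter eqxx iT => /(_ isT).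
move=> /allP/(_ (j, (t, k))); rewrite mem_filter eqxx jT => /(_ isT)/hasP[c _].
by exists c.
Qed.

(** Decided by evaluation: for each pair a certificate is looked up by its weights up to order, so
    its position in the list is immaterial. *)
Lemma mirror_pairs_certified :
  all (fun ij => certified_in coupling_certificates yonemura_table ij.1 ij.2)
    mirror_pairs.
Proof. by vm_compute. Qed.

Lemma mirror_pair_strongly_coupled i j w v :
    (i, j) \in mirror_pairs -> yonemura_number i w -> yonemura_number j v ->
  strongly_coupled_orderings w v.
Proof.
move=> /(allP mirror_pairs_certified) cert_ij [s [sT ws]] [t [tT vt]].
have [c /and3P[cs ct]] := certified_inP cert_ij sT tT.
(* Both the certificate and the given system reorder the same table entry, hence are permutations of
   each other. *)
by apply: coupling_certificateP; [rewrite (permPr ws) | rewrite (permPr vt)].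
Qed.

Theorem theorem2 (w v : weight_system 4) (wv_mirror : mirror_symmetric w v) :
  exists (a0 b0 : nat) (Wa Wb : weight_system 3),
    [/\ perm_eq (a0 :: weights Wa) (weights w),
        degree Wa = degree w
      & (a0 %| degree w)%N] /\
    [/\ perm_eq (b0 :: weights Wb) (weights v),
        degree Wb = degree v
      & (b0 %| degree v)%N] /\
    [/\ calabi_yau Wa, calabi_yau Wb & strongly_coupled Wa Wb].
Proof.
change (strongly_coupled_orderings w v).
have [i [j [[ij|ji] wi vj]]] := wv_mirror.
- exact: mirror_pair_strongly_coupled ij wi vj.
(* The pair is listed in the opposite order: couple [v] with [w], then exchange them by transposing
   the square. *)
- exact/strongly_coupled_orderings_sym/(mirror_pair_strongly_coupled ji vj wi).
Qed.
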